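(* Let $\widehat{G}_1$ be the signed graph constructed below. Then $\chi_{fb}(\widehat{G}_1)=2+\frac{2}{85}=\frac{172}{85}$.
   Context: A signed graph $(G,\sigma)$ is a graph with a signature $\sigma:E(G)\to\{+,-\}$; a cycle is negative if it has an odd number of negative edges; a vertex set is balanced if it induces no negative cycle. A balanced $(p,q)$-coloring assigns to each vertex $q$ colors from $\{1,\dots,p\}$ so that each color class is balanced; $\chi_{fb}$ is the minimum of $p/q$ over such colorings. $(K_4,-)$ denotes $K_4$ with all edges negative. The signed graph $\widehat{W}$: vertices $u,v,w,z,t,x_1,\dots,x_5$; edges $wx_i$ ($1\le i\le5$), $x_1x_2,x_2x_3,x_3x_4,x_4x_5,x_5x_1$, $zx_2,zx_3,zu,zv$, $tx_4,tx_5,tu,tv$, $ux_1,ux_2,ux_5,uv$, $vx_3,vx_4$; the edges $ux_2$ and $vx_4$ are positive and all other edges are negative. The signed graph $\widehat{W}'$ is obtained from $\widehat{W}$ by adding vertices $a_1,a_2,a_3,b_1,b_2,b_3$ with negative edges $a_1a_2,a_2a_3,a_1a_3,a_1x_1,a_1x_2,a_2u$, positive edges $a_2x_2,a_3u,a_3x_1$, negative edges $b_1b_2,b_2b_3,b_1b_3,b_1x_3,b_1x_4,b_2v$ and positive edges $b_2x_4,b_3v,b_3x_3$. In $\widehat{W}'$ the seven specified negative triangles are $wx_1x_2$, $wx_1x_5$, $wx_3x_4$, $zx_2x_3$, $tx_4x_5$, $a_1a_2a_3$, $b_1b_2b_3$. Let $\widehat{U}$ be obtained from $(K_4,-)$ by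 identifying each of its six edges with the edge $uv$ of a distinct copy of $\widehat{W}'$; $\widehat{U}$ thus has $42$ specified negative triangles. $\widehat{G}_1$ is obtained from $\widehat{U}$ by adding, for each of the $42$ specified triangles, a new vertex adjacent to its three vertices, with signs on the three new edges chosen so that the resulting $K_4$ is switching equivalent to $(K_4,-)$ (i.e., all four of its triangles are negative). *)

(* Defs.v *)
From HB Require Import structures.
From mathcomp Require Import all_boot all_order all_algebra.
Set Implicit Arguments.
Unset Strict Implicit.
Unset Printing Implicit Defensive.
Import Order.TTheory GRing.Theory Num.Theory.

(** * Signed graphs and balanced colorings *)

(* [sg_neg] is the set of negative edges; the other edges are positive. *)
Record sgraph (V : finType) := SGraph {
  sg_adj : rel V;
  sg_neg : rel V;
  sg_adj_sym : symmetric sg_adj;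
  sg_adj_irr : irreflexive sg_adj;
  sg_neg_sym : symmetric sg_neg;
  sg_neg_adj : subrel sg_neg sg_adj
}.

Section Colorings.
Variables (V : finType) (G : sgraph V).

Definition is_cycle (c : seq V) : bool :=
  [&& 2 < size c, uniq c & cycle (sg_adj G) c].

(* [zip c (rot 1 c)] lists the edges of the closed walk [c]. *)
Definition negative_cycle (c : seq V) : bool :=
  is_cycle c && odd (count (fun e => sg_neg G e.1 e.2) (zip c (rot 1 c))).

Definition balanced (S : {set V}) : Prop :=
  forall c : seq V, negative_cycle c -> ~ {subset c <= S}.

Definition balanced_coloring (p q : nat) (c : V -> {set 'I_p}) : Prop :=
  (forall x, #|c x| = q) /\ (forall i, balanced [set x | i \in c x]).

(* [r] is the minimum of p/q over all balanced (p,q)-colorings. *)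
Definition is_chi_fb (r : rat) : Prop :=
  (exists (p q : nat) (c : V -> {set 'I_p}),
     [/\ 0 < q, balanced_coloring q c & r = (p%:R / q%:R)%R]) /\
  (forall (p q : nat) (c : V -> {set 'I_p}),
     0 < q -> balanced_coloring q c -> (r <= p%:R / q%:R)%R).

(* [a], [b], [c], [d] induce a K4 that is switching equivalent to (K4,-). *)
Definition all_negative_K4 (a b c d : V) : bool :=
  [&& negative_cycle [:: a; b; c], negative_cycle [:: a; b; d],
      negative_cycle [:: a; c; d] & negative_cycle [:: b; c; d]].

End Colorings.

(** * Signed graphs given by a list of signed edges *)

(* The boolean is [true] for a negative edge. *)
Notation sedge V := (V * V * bool)%type.

Section OfEdges.
Variables (V : finType) (E : seq (sedge V)).

Definition joined (b : bool) : rel V :=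
  fun x y => (x != y) && (((x, y, b) \in E) || ((y, x, b) \in E)).

Lemma joined_sym b : symmetric (joined b).
Proof. by move=> x y; rewrite /joined eq_sym orbC. Qed.

(* In the lists used below, no pair of vertices occurs with both signs. *)
Definition of_edges : sgraph V.
Proof.
apply: (@SGraph V (fun x y => joined true x y || joined false x y)
          (joined true)).
- by move=> x y; rewrite !(joined_sym _ x).
- by move=> x; rewrite /joined eqxx.
- exact: joined_sym.
- by move=> x y ->.
Defined.

End OfEdges.

(** * The gadgets *)

(* Vertices of W' (and of W) other than [u] and [v]. *)
Inductive inner :=
  w | z | t | x1 | x2 | x3 | x4 | x5 | a1 | a2 | a3 | b1 | b2 | b3.

Definition inner_enum :=
  [:: w; z; t; x1; x2; x3; x4; x5; a1; a2; a3; b1; b2; b3].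

Definition inner_code (x : inner) : nat :=
  match x with
  | w => 0 | z => 1 | t => 2 | x1 => 3 | x2 => 4 | x3 => 5 | x4 => 6
  | x5 => 7 | a1 => 8 | a2 => 9 | a3 => 10 | b1 => 11 | b2 => 12 | b3 => 13
  end.

Lemma inner_codeK : cancel inner_code (nth w inner_enum).
Proof. by case. Qed.
HB.instance Definition _ := Countable.copy inner (can_type inner_codeK).
Lemma inner_enumP : Finite.axiom inner_enum.
Proof. by case. Qed.
HB.instance Definition _ := isFinite.Build inner inner_enumP.

Inductive wvert := u | v | Inner of inner.
Coercion Inner : inner >-> wvert.

Definition wvert_code (x : wvert) : bool + inner :=
  match x with u => inl false | v => inl true | Inner y => inr y end.
Definition wvert_decode (x : bool + inner) : wvert :=
  match x with inl false => u | inl true => v | inr y => Inner y end.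

Lemma wvert_codeK : cancel wvert_code wvert_decode.
Proof. by case. Qed.
HB.instance Definition _ := Finite.copy wvert (can_type wvert_codeK).

Definition neg_edge (x y : wvert) : sedge wvert := (x, y, true).
Definition pos_edge (x y : wvert) : sedge wvert := (x, y, false).
Local Notation "x [-] y" := (neg_edge x y) (at level 10).
Local Notation "x [+] y" := (pos_edge x y) (at level 10).

Definition W_edges : seq (sedge wvert) :=
  [:: w [-] x1; w [-] x2; w [-] x3; w [-] x4; w [-] x5;
      x1 [-] x2; x2 [-] x3; x3 [-] x4; x4 [-] x5; x5 [-] x1;
      z [-] x2; z [-] x3; z [-] u; z [-] v;
      t [-] x4; t [-] x5; t [-] u; t [-] v;
      u [-] x1; u [+] x2; u [-] x5; u [-] v;
      v [-] x3; v [+] x4].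

Definition W'_edges : seq (sedge wvert) :=
  W_edges ++
  [:: a1 [-] a2; a2 [-] a3; a1 [-] a3; a1 [-] x1; a1 [-] x2; a2 [-] u;
      a2 [+] x2; a3 [+] u; a3 [+] x1;
      b1 [-] b2; b2 [-] b3; b1 [-] b3; b1 [-] x3; b1 [-] x4; b2 [-] v;
      b2 [+] x4; b3 [+] v; b3 [+] x3].

(* The seven specified negative triangles of W'. *)
Inductive tri := wx1x2 | wx1x5 | wx3x4 | zx2x3 | tx4x5 | a1a2a3 | b1b2b3.

Definition tri_enum := [:: wx1x2; wx1x5; wx3x4; zx2x3; tx4x5; a1a2a3; b1b2b3].

Definition tri_code (d : tri) : nat :=
  match d with
  | wx1x2 => 0 | wx1x5 => 1 | wx3x4 => 2 | zx2x3 => 3 | tx4x5 => 4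
  | a1a2a3 => 5 | b1b2b3 => 6
  end.

Lemma tri_codeK : cancel tri_code (nth wx1x2 tri_enum).
Proof. by case. Qed.
HB.instance Definition _ := Countable.copy tri (can_type tri_codeK).
Lemma tri_enumP : Finite.axiom tri_enum.
Proof. by case. Qed.
HB.instance Definition _ := isFinite.Build tri tri_enumP.

Definition corners (d : tri) : inner * inner * inner :=
  match d with
  | wx1x2 => (w, x1, x2)
  | wx1x5 => (w, x1, x5)
  | wx3x4 => (w, x3, x4)
  | zx2x3 => (z, x2, x3)
  | tx4x5 => (t, x4, x5)
  | a1a2a3 => (a1, a2, a3)
  | b1b2b3 => (b1, b2, b3)
  end.

(** * The graph U *)

Inductive k4v := k1 | k2 | k3 | k4.

Definition k4v_enum := [:: k1; k2; k3; k4].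
Definition k4v_code (i : k4v) : nat :=
  match i with k1 => 0 | k2 => 1 | k3 => 2 | k4 => 3 end.

Lemma k4v_codeK : cancel k4v_code (nth k1 k4v_enum).
Proof. by case. Qed.
HB.instance Definition _ := Countable.copy k4v (can_type k4v_codeK).
Lemma k4v_enumP : Finite.axiom k4v_enum.
Proof. by case. Qed.
HB.instance Definition _ := isFinite.Build k4v k4v_enumP.

Inductive k4e := k12 | k13 | k14 | k23 | k24 | k34.

Definition k4e_enum := [:: k12; k13; k14; k23; k24; k34].
Definition k4e_code (e : k4e) : nat :=
  match e with
  | k12 => 0 | k13 => 1 | k14 => 2 | k23 => 3 | k24 => 4 | k34 => 5
  end.

Lemma k4e_codeK : cancel k4e_code (nth k12 k4e_enum).
Proof. by case. Qed.
HB.instance Definition _ := Countable.copy k4e (can_type k4e_codeK).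
Lemma k4e_enumP : Finite.axiom k4e_enum.
Proof. by case. Qed.
HB.instance Definition _ := isFinite.Build k4e k4e_enumP.

Definition ends (e : k4e) : k4v * k4v :=
  match e with
  | k12 => (k1, k2) | k13 => (k1, k3) | k14 => (k1, k4)
  | k23 => (k2, k3) | k24 => (k2, k4) | k34 => (k3, k4)
  end.

Definition uvert : Type := k4v + k4e * inner.
HB.instance Definition _ := Finite.on uvert.

(* An edge of K4 can be identified with [u v] in two ways; [o e] selects which
   end of [e] becomes [u]. [place o e] maps the copy of W' attached along [e]
   into U. *)
Definition place (o : k4e -> bool) (e : k4e) (x : wvert) : uvert :=
  match x with
  | u => inl (if o e then (ends e).2 else (ends e).1)
  | v => inl (if o e then (ends e).1 else (ends e).2)
  | Inner y => inr (e, y)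
  end.

(* The edge [u v] of each copy repeats the K4 edge it is identified with, with
   the same (negative) sign. *)
Definition U_edges (o : k4e -> bool) : seq (sedge uvert) :=
  [seq (inl (ends e).1, inl (ends e).2, true) | e <- k4e_enum] ++
  [seq (place o e f.1.1, place o e f.1.2, f.2) | e <- k4e_enum, f <- W'_edges].

(** * The graph G1 *)

Definition gvert : Type := uvert + k4e * tri.
HB.instance Definition _ := Finite.on gvert.

Definition corner1 (e : k4e) (d : tri) : gvert := inl (inr (e, (corners d).1.1)).
Definition corner2 (e : k4e) (d : tri) : gvert := inl (inr (e, (corners d).1.2)).
Definition corner3 (e : k4e) (d : tri) : gvert := inl (inr (e, (corners d).2)).
Definition apex (e : k4e) (d : tri) : gvert := inr (e, d).

(* [s e d] gives the signs of the edges from the new vertex [apex e d] to the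
   three corners of its triangle ([true] for negative). *)
Definition G1_edges (o : k4e -> bool) (s : k4e -> tri -> bool * bool * bool) :
    seq (sedge gvert) :=
  [seq (inl f.1.1, inl f.1.2, f.2) | f <- U_edges o] ++
  [seq (apex e d, corner1 e d, (s e d).1.1) | e <- k4e_enum, d <- tri_enum] ++
  [seq (apex e d, corner2 e d, (s e d).1.2) | e <- k4e_enum, d <- tri_enum] ++
  [seq (apex e d, corner3 e d, (s e d).2) | e <- k4e_enum, d <- tri_enum].

Definition G1 (o : k4e -> bool) (s : k4e -> tri -> bool * bool * bool) :
  sgraph gvert := of_edges (G1_edges o s).

Definition admissible_signs (o : k4e -> bool)
    (s : k4e -> tri -> bool * bool * bool) : Prop :=
  forall (e : k4e) (d : tri),
    all_negative_K4 (G1 o s) (apex e d) (corner1 e d) (corner2 e d) (corner3 e d).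

(* Main.v *)
(** A balanced set contains at most 2 vertices of a [K4] whose triangles are all
    negative.  The graph [G1] contains 43 such [K4]s: the one on [k1, ..., k4]
    and one at each apex.  If a balanced set contains 2 of [k1, ..., k4], they
    are the ends [u], [v] of some copy of W', and in W' no balanced set
    containing [u] and [v] meets all seven specified triangles; hence one of the
    apex [K4]s contains at most 1 of its vertices.  So a balanced set meets the
    43 [K4]s at most 85 times in total, while in a [(p, q)]-coloring they are met
    [172 q] times: [172 q <= 85 p].

    Equality forces the shape of an optimal coloring with 172 colors: each
    edge of [K4] is the trace on [k1, ..., k4] of 28 colors, and each vertex of
    one color.  In each copy of W', 28 colors contain both [u] and [v], 57
    only [u], 57 only [v] and 30 neither, and a color can be extended to the
    copies independently, since each copy shares with the rest at most an edge. *)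
Require Import Defs.
From mathcomp Require Import all_boot all_order all_algebra.
Set Implicit Arguments.
Unset Strict Implicit.
Unset Printing Implicit Defensive.
Import Order.TTheory GRing.Theory Num.Theory.

(** * Balanced sets *)

Section Balanced.
Variables (V : finType) (G : sgraph V).

(** Inside [S] the sign is the coboundary of [f], so the parity of negative edges telescopes along a
    path. *)
Lemma odd_neg_path (S : {set V}) (f : V -> bool) (x y : V) (p : seq V) :
  {in S &, forall a b, sg_adj G a b -> sg_neg G a b = f a (+) f b} ->
  {subset x :: rcons p y <= S} -> path (sg_adj G) x (rcons p y) ->
  odd (count (fun e => sg_neg G e.1 e.2) (zip (x :: p) (rcons p y)))
    = f x (+) f y.
Proof.
move=> fP; elim: p x => [|a p IHp] x sS /=.
  rewrite andbT addn0 => xy.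
  by rewrite oddb fP // sS // !inE eqxx ?orbT.
case/andP=> xa ap; have aS : {subset a :: rcons p y <= S}.
  by move=> b bp; apply: sS; rewrite inE bp orbT.
have xS : x \in S by rewrite sS ?mem_head.
by rewrite oddD oddb IHp // fP // ?aS ?mem_head // addbA -(addbA (f x)) addbb addbF.
Qed.

(** The easy half of Harary's balance criterion: around a cycle the parity telescopes to
    [f x (+) f x]. *)
Lemma switching_balanced (S : {set V}) (f : V -> bool) :
  {in S &, forall a b, sg_adj G a b -> sg_neg G a b = f a (+) f b} ->
  balanced G S.
Proof.
move=> fP c /andP[/and3P[_ _]].
case: c => [|x p] //= xp; rewrite rot1_cons => + cS.
rewrite (odd_neg_path fP) ?addbb // => a.
by rewrite inE mem_rcons => /predU1P[->|]; apply: cS; rewrite ?inE ?eqxx.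
Qed.

Lemma balanced_all (S : {set V}) (c : seq V) :
  balanced G S -> negative_cycle G c -> ~~ all [in S] c.
Proof. by move=> Sb /Sb cS; apply/negP => /allP. Qed.

Lemma negative_triangle (a b c : V) :
  sg_neg G a b -> sg_neg G b c -> sg_neg G c a -> negative_cycle G [:: a; b; c].
Proof.
have ne x y : sg_neg G x y -> x != y.
  by move/sg_neg_adj; apply: contraTneq => ->; rewrite sg_adj_irr.
move=> ab bc ca; rewrite /negative_cycle /is_cycle /= !sg_neg_adj // ab bc ca.
by rewrite !inE negb_or (ne _ _ ab) (ne _ _ bc) eq_sym (ne _ _ ca).
Qed.

(** Any three of the four vertices form a negative triangle. *)
Lemma balanced_K4_le2 (S : {set V}) (a b c d : V) :
  balanced G S -> all_negative_K4 G a b c d ->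
  (a \in S) + (b \in S) + (c \in S) + (d \in S) <= 2.
Proof.
move=> Sb /and4P[/(balanced_all Sb) + /(balanced_all Sb) +
  /(balanced_all Sb) + /(balanced_all Sb)]; rewrite /= !andbT.
by case: (a \in S); case: (b \in S); case: (c \in S); case: (d \in S).
Qed.

Lemma sum_card_colors (p : nat) (c : V -> {set 'I_p}) (x : V) :
  \sum_i (x \in [set y | i \in c y]) = #|c x|.
Proof.
rewrite -sum1_card [RHS]big_mkcond; apply: eq_bigr => i _.
by rewrite inE; case: ifP.
Qed.

End Balanced.

Lemma of_edges_switching_balanced (V : finType) (E : seq (sedge V))
    (S : {set V}) (f : V -> bool) :
  (forall x y b, (x, y, b) \in E -> x \in S -> y \in S -> b = f x (+) f y) ->
  balanced (of_edges E) S.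
Proof.
move=> fP; apply: (@switching_balanced _ _ _ f) => x y xS yS /=.
have jP b : joined E b x y -> b = f x (+) f y.
  by case/andP=> _ /orP[] /fP ->; rewrite // addbC.
by case: (joined E true x y) (jP true) => [->//|_] /=; apply: jP.
Qed.

(** * Lower bound *)

Lemma zip_map_pair (A B : Type) (h : A -> B) (a b : seq A) :
  zip (map h a) (map h b) = [seq (h e.1, h e.2) | e <- zip a b].
Proof. by elim: a b => [|x a IHa] [|y b] //=; rewrite IHa. Qed.

Section Gadget.
Variables (o : k4e -> bool) (s : k4e -> tri -> bool * bool * bool).

(** * Copies of W' as induced signed subgraphs *)

Lemma place_inj (e : k4e) : injective (place o e).
Proof.
move=> [||x] [||y] //= []; last by move=> ->.
- by case: (o e); case: e.
- by case: (o e); case: e.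
Qed.

Lemma mem_G1_inl (x y : uvert) (b : bool) :
  ((inl x, inl y, b) \in G1_edges o s) = ((x, y, b) \in U_edges o).
Proof.
apply/idP/idP => [|xyU].
  rewrite mem_cat => /orP[/mapP[[[x' y'] b'] fU [-> -> ->]] //|].
  by rewrite mem_cat => /orP[|]; [|rewrite mem_cat => /orP[]];
    case/allpairsP=> -[? ?] [].
by rewrite mem_cat; apply/orP; left; apply/mapP; exists (x, y, b).
Qed.

Lemma W'_edges_uv (x y : wvert) (b : bool) :
  (x, y, b) \in W'_edges ->
  [|| (x, y, b) == (u, v, true), ~~ (x \in [:: u; v]) | ~~ (y \in [:: u; v])].
Proof.
move=> fW'; pose ends_uv (f : sedge wvert) := [|| f == (u, v, true),
  f.1.1 \notin [:: u; v] | f.1.2 \notin [:: u; v]].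
have : all ends_uv W'_edges by vm_compute.
by move/allP/(_ _ fW').
Qed.

(** [K4] and the other copies can only contribute an edge between [u] and [v], and that edge is
    negative in W' too. *)
Lemma mem_U_place (b : bool) (e : k4e) (x y : wvert) :
  x != y -> (place o e x, place o e y, b) \in U_edges o ->
  joined W'_edges b x y.
Proof.
move=> xy; rewrite mem_cat => /orP[/mapP[e' _ []]|].
  by case: x xy => [||x]; case: y => [||y] // _ _ _ ->.
case/allpairsP=> -[e' [[x' y'] b']] /= [_ fW' [ex ey ->{b}]].
have [e_e'|ne] := eqVneq e e'.
  move: ex ey xy; rewrite e_e' => /place_inj -> /place_inj -> xy.
  by rewrite /joined xy fW'.
have uv c c' : place o e c = place o e' c' ->
    (c \in [:: u; v]) && (c' \in [:: u; v]).
  by case: c => [||c]; case: c' => [||c'] //= [ee']; rewrite ee' eqxx in ne.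
have /andP[xuv x'uv] := uv _ _ ex; have /andP[yuv y'uv] := uv _ _ ey.
have := W'_edges_uv fW'; rewrite x'uv y'uv !orbF => /eqP[_ _ ->].
by case: x y xy xuv yuv {ex ey} => [||?] [||?].
Qed.

Lemma joined_place (b : bool) (e : k4e) (x y : wvert) :
  joined (G1_edges o s) b (inl (place o e x)) (inl (place o e y))
    = joined W'_edges b x y.
Proof.
rewrite {1}/joined !mem_G1_inl (inj_eq (@inl_inj _ _)) (inj_eq (@place_inj e)).
apply/idP/idP.
  case/andP=> xy /orP[/(mem_U_place xy) //|]; rewrite joined_sym.
  by apply: mem_U_place; rewrite eq_sym.
case/andP=> -> /=.
have m x' y' : (x', y', b) \in W'_edges -> (place o e x', place o e y', b) \in U_edges o.
  move=> fW'; rewrite mem_cat; apply/orP; right; apply/allpairsP; exists (e, (x', y', b)); split=> //.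
  by case: (e).
by case/orP=> /m ->; rewrite ?orbT.
Qed.

Lemma negative_cycle_place (e : k4e) (c : seq wvert) :
  negative_cycle (of_edges W'_edges) c ->
  negative_cycle (G1 o s) [seq inl (place o e x) | x <- c].
Proof.
have inj : injective (fun x => inl (place o e x) : gvert).
  by move=> x y [/place_inj].
case/andP=> /and3P[c2 cu cc] codd; apply/andP; split.
  rewrite /is_cycle size_map c2 map_inj_uniq // cu /=.
  case: c cc {c2 cu codd} => //= x p; rewrite -map_rcons path_map.
  by congr is_true; apply: eq_path => a b; rewrite /relpre /= !joined_place.
rewrite -map_rot zip_map_pair count_map; congr (is_true (odd _)): codd.
by apply: eq_count => -[a b] /=; rewrite joined_place.
Qed.

(** * Balanced sets containing both ends of a copy *)

Definition W'_cycles : seq (seq wvert) :=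
  [:: [:: u; v; Inner z]; [:: u; v; Inner t]; [:: u; Inner x1; Inner x5];
      [:: u; Inner x2; Inner a2]; [:: u; Inner x1; Inner a3];
      [:: v; Inner x3; Inner b3]; [:: v; Inner x4; Inner b2];
      [:: Inner x1; Inner x2; Inner a1]; [:: Inner x3; Inner x4; Inner b1];
      [:: u; v; Inner x3; Inner x2]; [:: u; v; Inner x4; Inner x5];
      [:: u; Inner x2; Inner w; Inner x5];
      [:: u; v; Inner x3; Inner w; Inner x5];
      [:: u; v; Inner x4; Inner w; Inner x2]].

Lemma W'_cycles_negative : all (negative_cycle (of_edges W'_edges)) W'_cycles.
Proof. by vm_compute. Qed.

(** Suppose all seven triangles are met. The cycles exclude [z] and [t], so exactly one of [x2],
    [x3] and exactly one of [x4], [x5] is in [S]. With [x2], [x5], [w] is excluded and [wx3x4] is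
    missed; with [x3], [x5], [w] and [x1] are excluded and [wx1x2] is missed; [x2], [x4] exclude
    [w], hence force [x1], and [a1a2a3] is missed; with [x3], [x4], [b1b2b3] is missed. *)
Lemma W'_cycles_unavoidable (S : pred wvert) :
  S u -> S v -> all (fun c => ~~ all S c) W'_cycles ->
  exists d, ~~ [|| S (corners d).1.1, S (corners d).1.2 | S (corners d).2].
Proof.
move=> Su Sv Sc; apply/existsP; move: Sc; apply: contraTT.
rewrite negb_exists => /forallP H; apply/negP => /=; rewrite Su Sv /=.
move: (H wx1x2) (H wx1x5) (H wx3x4) (H zx2x3) (H tx4x5) (H a1a2a3) (H b1b2b3).
rewrite /= !negbK !andbT.
case: (S z) => //=; case: (S t) => //=; case: (S x2); case: (S x3) => //=;
case: (S x4); case: (S x5) => //=; case: (S x1); case: (S w) => //=;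
by case: (S a1); case: (S a2); case: (S a3); case: (S b1); case: (S b2);
   case: (S b3).
Qed.

Lemma balanced_misses_triangle (S : {set gvert}) (e : k4e) :
  balanced (G1 o s) S -> inl (inl (ends e).1) \in S -> inl (inl (ends e).2) \in S ->
  exists d, [/\ corner1 e d \notin S, corner2 e d \notin S & corner3 e d \notin S].
Proof.
move=> Sb S1 S2; pose T x := inl (place o e x) \in S.
have [|||d] := @W'_cycles_unavoidable T.
- by rewrite /T /=; case: (o e).
- by rewrite /T /=; case: (o e).
- apply/allP => c cW; have /allP/(_ c cW) := W'_cycles_negative.
  by move/(negative_cycle_place e)/(balanced_all Sb); rewrite all_map.
by rewrite !negb_or => /and3P[]; exists d.
Qed.

(** * Double counting over the 43 [K4]s *)

Definition K4_count (S : {set gvert}) : nat :=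
  \sum_(k : k4v) (inl (inl k) \in S).

Definition apex_K4_count (S : {set gvert}) (e : k4e) (d : tri) : nat :=
  (apex e d \in S) + (corner1 e d \in S) + (corner2 e d \in S)
    + (corner3 e d \in S).

Lemma big_k4v (F : k4v -> nat) :
  \sum_k F k = F k1 + F k2 + F k3 + F k4.
Proof.
have enumE : enum {: k4v} = k4v_enum by rewrite enumT unlock.
by rewrite -big_enum enumE !big_cons big_nil /= !addnA addn0.
Qed.

Lemma K4_count_le2 (S : {set gvert}) : balanced (G1 o s) S -> K4_count S <= 2.
Proof.
move=> Sb; rewrite /K4_count big_k4v; apply: (balanced_K4_le2 Sb).
have negT (i j : k4v) : i != j -> sg_neg (G1 o s) (inl (inl i)) (inl (inl j)).
  have mU f : f \in [seq (inl (ends e).1, inl (ends e).2, true) | e <- k4e_enum] ->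
    f \in U_edges o by move=> fK; rewrite mem_cat fK.
  move=> ij; rewrite /sg_neg /= /joined !mem_G1_inl ij; apply/orP.
  by case: i j ij => [] [] // _; (left; exact: mU) || (right; exact: mU).
by apply/and4P; split; apply: negative_triangle; apply: negT.
Qed.

Lemma balanced_K4_sum (S : {set gvert}) :
  admissible_signs o s -> balanced (G1 o s) S ->
  K4_count S + \sum_(x : k4e * tri) apex_K4_count S x.1 x.2 <= 85.
Proof.
move=> hs Sb; have le2 x : apex_K4_count S x.1 x.2 <= 2.
  exact: balanced_K4_le2 Sb (hs x.1 x.2).
have card_et : #|{: k4e * tri}| = 42 by rewrite card_prod !cardT !enumT unlock.
have [K1|K2] := leqP (K4_count S) 1.
  (* Here [84 = 2 * 42]. *)
  rewrite (leq_add (n1 := 1) (n2 := 84)) //.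
  by rewrite (leq_trans (leq_sum _ (fun x _ => le2 x))) // sum_nat_const card_et.
have [e S1 S2] : exists2 e, inl (inl (ends e).1) \in S & inl (inl (ends e).2) \in S.
  move: K2; rewrite /K4_count big_k4v.
  case E1: (inl (inl k1) \in S); case E2: (inl (inl k2) \in S);
  case E3: (inl (inl k3) \in S); case E4: (inl (inl k4) \in S) => // _;
  by [exists k12|exists k13|exists k14|exists k23|exists k24|exists k34].
have [d [c1 c2 c3]] := balanced_misses_triangle Sb S1 S2.
rewrite (leq_add (n1 := 2) (n2 := 83)) ?K4_count_le2 //.
(* The missed triangle leaves at most the apex in its [K4]; the other 41 contribute at most
   [82 = 2 * 41]. *)
rewrite (bigD1 (e, d)) //= (leq_add (n1 := 1) (n2 := 82)) //.
  by rewrite /apex_K4_count (negPf c1) (negPf c2) (negPf c3) !addn0 leq_b1.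
rewrite (leq_trans (leq_sum _ (fun x _ => le2 x))) // sum_nat_const.
by rewrite cardC1 card_et.
Qed.

Lemma balanced_coloring_bound (p q : nat) (c : gvert -> {set 'I_p}) :
  admissible_signs o s -> balanced_coloring (G1 o s) q c -> 172 * q <= 85 * p.
Proof.
move=> hs [cq cb].
have : \sum_i (K4_count [set x | i \in c x]
    + \sum_(x : k4e * tri) apex_K4_count [set x | i \in c x] x.1 x.2) <= 85 * p.
  by rewrite (leq_trans (leq_sum _ (fun i _ => balanced_K4_sum hs (cb i)))) //
             sum_nat_const card_ord mulnC.
(* Summing over colors first, each vertex of each [K4] counts [q] times, and [4 + 42 * 4 = 172]. *)
apply: leq_trans; rewrite big_split /= exchange_big [X in _ + X]exchange_big /=.
under eq_bigr do rewrite sum_card_colors cq.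
under [X in _ + X]eq_bigr do rewrite !big_split /= !sum_card_colors !cq.
rewrite !sum_nat_const card_prod !cardT !enumT unlock /=.
have -> : q + q + q + q = 4 * q by rewrite !mulSn mul0n addn0 !addnA.
by rewrite mulnA -mulnDl.
Qed.

End Gadget.













(** * Upper bound *)

Section Deal.
Variables (K : finType) (A : eqType) (a0 : A).

(* Each key takes the next unused element of its own queue. *)
Fixpoint deal (q : K -> seq A) (ks : seq K) : seq A :=
  if ks is k :: ks' then
    head a0 (q k) :: deal (fun k' => if k' == k then behead (q k') else q k') ks'
  else [::].

Lemma size_deal (q : K -> seq A) (ks : seq K) : size (deal q ks) = size ks.
Proof. by elim: ks q => //= k ks IHks q; rewrite IHks. Qed.

(** The invariant of dealing: each queue is as long as its key has turns left, so the next queue is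
    nonempty and the default [a0] is never dealt. *)
Lemma deal_step (q : K -> seq A) (k : K) (ks : seq K) :
  (forall k', count_mem k' (k :: ks) = size (q k')) ->
  q k = head a0 (q k) :: behead (q k) /\
  (forall k', count_mem k' ks = size (if k' == k then behead (q k') else q k')).
Proof.
move=> qP; split; first by have := qP k; rewrite /= eqxx; case: (q k).
move=> k'; have := qP k'; rewrite /= eq_sym.
by case: eqP => // _; rewrite size_behead => <-.
Qed.

Lemma nth_deal (q : K -> seq A) (ks : seq K) (k0 : K) (i : nat) :
  (forall k, count_mem k ks = size (q k)) -> i < size ks ->
  nth a0 (deal q ks) i \in q (nth k0 ks i).
Proof.
elim: ks q i => //= k ks IHks q [|i] qP; have [qk q'P] := deal_step qP.
  by rewrite /= {2}qk mem_head.
move=> /(IHks _ _ q'P) /=; case: eqP => // _; exact: mem_behead.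
Qed.

(** Every queue is used up exactly, in whatever order the keys come. *)
Lemma count_deal (a : pred A) (q : K -> seq A) (ks : seq K) :
  (forall k, count_mem k ks = size (q k)) ->
  count a (deal q ks) = \sum_k count a (q k).
Proof.
elim: ks q => [|k ks IHks] q qP /=.
  by rewrite big1 // => k _; rewrite (size0nil (esym (qP k))).
have [qk q'P] := deal_step qP; rewrite (IHks _ q'P).
rewrite (bigD1 k) // [RHS](bigD1 k) //= eqxx addnA {3}qk /=; congr (_ + _).
by apply: eq_bigr => k' /negPf ->.
Qed.

End Deal.

Lemma sum_bool_pair (F : bool * bool -> nat) :
  \sum_uv F uv = F (true, true) + F (true, false) + F (false, true) + F (false, false).
Proof.
rewrite (eq_bigr (fun uv => F (uv.1, uv.2))) => [|[]//].
by rewrite -(pair_bigA _ (fun b c => F (b, c))) /= !big_bool /= addnA.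
Qed.

Lemma card_ord_count (n : nat) (a : pred nat) :
  #|[set i : 'I_n | a i]| = count a (iota 0 n).
Proof.
rewrite -sum1_card (eq_bigl (fun i : 'I_n => a i)); last by move=> i; rewrite inE.
by rewrite -(big_mkord a (fun _ => 1)) sum1_count /index_iota subn0.
Qed.

Lemma count_nth_iota (A : Type) (a : pred A) (a0 : A) (l : seq A) :
  count (fun i => a (nth a0 l i)) (iota 0 (size l)) = count a l.
Proof. by rewrite -[in RHS](mkseq_nth a0 l) count_map. Qed.

(** * The coloring with 172 colors *)

Section Coloring.

(** There are [6 * 28 + 4 = 172] traces, and each vertex is in [3 * 28 + 1 = 85] of them. *)
Definition k4_parts : seq (seq k4v) :=
  flatten [seq nseq 28 [:: (ends e).1; (ends e).2] | e <- k4e_enum]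
    ++ [seq [:: k] | k <- k4v_enum].

(* A balanced set, split into the two sides of a switching that makes all its
   edges positive. *)
Definition piece := (seq inner * seq inner)%type.

Definition in_piece (P : piece) (y : inner) : bool := y \in P.1 ++ P.2.

(* The balanced sets used in a copy of W', with multiplicities, according to
   whether [u] and [v] are in the set.  They were found by computer search, so
   that every vertex of W' and every apex is covered exactly 85 times. *)
Definition palette (uv : bool * bool) : seq piece :=
  flatten [seq nseq n.1 n.2 | n <-
    match uv with
    | (true, true) =>
        [:: (4, ([:: x3; a3; b2], [:: x5; b1]));
            (4, ([:: x2; a3; b1], [:: x4]));
            (4, ([:: x2; b2], [:: x5; a1; b3]));
            (4, ([:: b1], [:: x1; x4; a2]));
            (4, ([:: x3; a3; b2], [:: w]));
            (4, ([:: x2; b1], [:: x1; x4; b3]));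
            (2, ([:: x3; a1], [:: x1; x4]));
            (2, ([:: x3], [:: x1; x4; a2]))]
    | (true, false) =>
        [:: (18, ([:: x2; x4], [:: w; z; t; a1; b1]));
            (9, ([:: x3; b2], [:: z; t; x1; a2]));
            (7, ([:: x3], [:: z; x1; x4; a2; b2]));
            (2, ([:: x2; x4; b2], [:: w; t; a1; b1]));
            (1, ([:: w; a1; b3], [:: z; t]));
            (16, ([:: x2; x4; a3; b3], [:: z; x5; a1]));
            (4, ([:: w; a3; b1], [:: t; x3; b3]))]
    | (false, true) =>
        [:: (31, ([:: x2; x5; a2; b1], [:: t; x1; x3; a3; b2]));
            (18, ([:: x1; x4; a2; b3], [:: w; z; t; a1]));
            (8, ([:: x1; x4; a2; b3], [:: w; z; b1]))]
    | (false, false) =>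
        [:: (6, ([:: w; z; b1], [:: x2; x5; a2; b3]));
            (2, ([:: w; z; t; a1; b2], [:: x5; b3]));
            (22, ([:: w; a1; b2], [:: x3; x5; a3; b3]))]
    end].

Arguments palette : simpl never.

Definition uend (b : bool) (e : k4e) : k4v := if b then (ends e).2 else (ends e).1.
Definition vend (b : bool) (e : k4e) : k4v := if b then (ends e).1 else (ends e).2.

Definition uv_state (b : bool) (e : k4e) (K : seq k4v) : bool * bool :=
  (uend b e \in K, vend b e \in K).

Definition pieces (b : bool) (e : k4e) : seq piece :=
  deal ([::], [::]) palette [seq uv_state b e K | K <- k4_parts].

(** An apex with at most one neighbour in the set lies on no cycle there, so adding it preserves
    balance. *)
Definition in_apex (P : piece) (d : tri) : bool :=
  count (in_piece P) [:: (corners d).1.1; (corners d).1.2; (corners d).2] <= 1.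

(** Both ends: 28 traces. One given end only: two other edges and a singleton, [2 * 28 + 1 = 57].
    Neither: the opposite edge and two singletons, [28 + 2 = 30]. *)
Lemma uv_state_count (b : bool) (e : k4e) (uv : bool * bool) :
  count_mem uv [seq uv_state b e K | K <- k4_parts] = size (palette uv).
Proof.
by apply/eqP; case: b e uv => [] [] [[] []]; vm_compute.
Qed.

Lemma size_k4_parts : size k4_parts = 172.
Proof. by apply/eqP; vm_compute. Qed.

Lemma size_pieces (b : bool) (e : k4e) : size (pieces b e) = 172.
Proof. by rewrite size_deal size_map size_k4_parts. Qed.

(** All copies receive the same multiset of pieces, so coverage becomes one finite check on W'. *)
Lemma count_pieces (a : pred piece) (b : bool) (e : k4e) :
  count a (pieces b e) =
    count a (palette (true, true)) + count a (palette (true, false))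
    + count a (palette (false, true)) + count a (palette (false, false)).
Proof.
by rewrite count_deal => [|uv]; [rewrite sum_bool_pair | exact: uv_state_count].
Qed.

Variables (o : k4e -> bool) (s : k4e -> tri -> bool * bool * bool).

Definition k4_part (i : nat) : seq k4v := nth [::] k4_parts i.
Definition copy_piece (i : nat) (e : k4e) : piece :=
  nth ([::], [::]) (pieces (o e) e) i.

Definition color_class (i : nat) (x : gvert) : bool :=
  match x with
  | inl (inl k) => k \in k4_part i
  | inl (inr (e, y)) => in_piece (copy_piece i e) y
  | inr (e, d) => in_apex (copy_piece i e) d
  end.

Definition coloring (x : gvert) : {set 'I_172} := [set i : 'I_172 | color_class i x].

Lemma card_coloring (x : gvert) : #|coloring x| = 85.
Proof.
rewrite (card_ord_count _ (fun i => color_class i x)).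
case: x => [[k|[e y]]|[e d]].
- transitivity (count (fun K : seq k4v => k \in K) k4_parts).
    by rewrite -(count_nth_iota _ [::]) size_k4_parts.
  by apply/eqP; case: k; vm_compute.
- transitivity (count (fun P => in_piece P y) (pieces (o e) e)).
    by rewrite -(count_nth_iota _ ([::], [::])) size_pieces.
  by rewrite count_pieces; apply/eqP; case: y; vm_compute.
- transitivity (count (fun P => in_apex P d) (pieces (o e) e)).
    by rewrite -(count_nth_iota _ ([::], [::])) size_pieces.
  by rewrite count_pieces; apply/eqP; case: d; vm_compute.
Qed.

(** * Switchings of the color classes *)

Definition k4_switch (K : seq k4v) (k : k4v) : bool := k != head k1 K.

Lemma k4_switch_ends (K : seq k4v) (e : k4e) :
  K \in k4_parts -> (ends e).1 \in K -> (ends e).2 \in K ->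
  k4_switch K (ends e).1 (+) k4_switch K (ends e).2.
Proof.
move=> KP; pose ok K e := ((ends e).1 \in K) ==> ((ends e).2 \in K) ==>
  (k4_switch K (ends e).1 (+) k4_switch K (ends e).2).
have : all (fun K => all (ok K) k4e_enum) k4_parts by vm_compute.
have eE : e \in k4e_enum by case: (e).
move/allP/(_ _ KP)/allP/(_ _ eE)/implyP => okE e1K e2K.
by have /implyP/(_ e2K) := okE e1K.
Qed.

Definition in_copy (uv : bool * bool) (P : piece) (x : wvert) : bool :=
  match x with u => uv.1 | v => uv.2 | Inner y => in_piece P y end.

(** If [u] is present, the negative edge [uv] forces the value [true] at [v]; otherwise [v] gets
    [false]. *)
Definition copy_switch (uv : bool * bool) (P : piece) (x : wvert) : bool :=
  match x with u => false | v => uv.1 | Inner y => y \in P.2 end.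

(** The certificate for the searched palettes: each piece is checked against each edge of W'. *)
Lemma palette_switch (uv : bool * bool) (P : piece) (x y : wvert) (b : bool) :
  P \in palette uv -> (x, y, b) \in W'_edges -> in_copy uv P x ->
  in_copy uv P y -> b = copy_switch uv P x (+) copy_switch uv P y.
Proof.
move=> PP xyW; pose ok P (f : sedge wvert) := in_copy uv P f.1.1 ==>
  in_copy uv P f.1.2 ==> (f.2 == copy_switch uv P f.1.1 (+) copy_switch uv P f.1.2).
have : all (fun P => all (ok P) W'_edges) (palette uv).
  by case: uv @ok {PP} => [[] []]; vm_compute.
move/allP/(_ _ PP)/allP/(_ _ xyW)/implyP => okE xP yP.
by have /implyP/(_ yP)/eqP := okE xP.
Qed.

(* Aligns the switching of a piece, which is normalised by [copy_switch] at [u]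
   and [v], with the one of [k4_part i]. *)
Definition copy_flip (i : nat) (e : k4e) : bool :=
  if uend (o e) e \in k4_part i then k4_switch (k4_part i) (uend (o e) e)
  else if vend (o e) e \in k4_part i then k4_switch (k4_part i) (vend (o e) e)
  else false.

Definition inner_switch (i : nat) (e : k4e) (y : inner) : bool :=
  (y \in (copy_piece i e).2) (+) copy_flip i e.

(* An apex has at most one neighbour in its color class; its switch is chosen
   to fit that neighbour. *)
Definition color_switch (i : nat) (x : gvert) : bool :=
  match x with
  | inl (inl k) => k4_switch (k4_part i) k
  | inl (inr (e, y)) => inner_switch i e y
  | inr (e, d) =>
      let: (y1, y2, y3) := corners d in
      if in_piece (copy_piece i e) y1 then inner_switch i e y1 (+) (s e d).1.1
      else if in_piece (copy_piece i e) y2 then inner_switch i e y2 (+) (s e d).1.2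
      else inner_switch i e y3 (+) (s e d).2
  end.

Lemma color_class_place (i : nat) (e : k4e) (x : wvert) :
  color_class i (inl (place o e x))
    = in_copy (uv_state (o e) e (k4_part i)) (copy_piece i e) x.
Proof. by case: x. Qed.

Lemma color_switch_place (i : nat) (e : k4e) (x : wvert) :
  i < 172 -> color_class i (inl (place o e x)) ->
  color_switch i (inl (place o e x))
    = copy_switch (uv_state (o e) e (k4_part i)) (copy_piece i e) x (+) copy_flip i e.
Proof.
move=> i_lt; case: x => [||y] //=; rewrite /copy_flip -/(uend _ _) -/(vend _ _).
  by move=> ->.
move=> vK; rewrite vK; case: ifP => // uK.
(* Both ends are in the trace, so their switches differ, which agrees with [copy_switch] being
   [true] at [v]. *)
have KP : k4_part i \in k4_parts by apply: mem_nth.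
have := @k4_switch_ends _ e KP; rewrite /uend /vend in uK vK *.
by case: (o e) uK vK => -> -> /(_ isT isT);
  case: (k4_switch _ _); case: (k4_switch _ _).
Qed.

Lemma color_class_balanced (i : nat) :
  i < 172 -> balanced (G1 o s) [set x | color_class i x].
Proof.
move=> i_lt; apply: (@of_edges_switching_balanced _ _ _ (color_switch i)) => x y b xyE.
rewrite !in_set; move: xyE; rewrite mem_cat => /orP[/mapP[[[x' y'] b'] + [-> -> ->]]|].
  rewrite mem_cat => /orP[/mapP[e _ [-> -> ->]]|].
    by move=> xK yK; rewrite /= k4_switch_ends // mem_nth.
  case/allpairsP=> -[e [[x'' y''] b'']] [_ fW [-> -> ->]] xC yC.
  (* The flip, common to both ends of the edge, cancels. *)
  rewrite !color_switch_place // addbACA addbb addbF.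
  rewrite color_class_place in xC; rewrite color_class_place in yC.
  apply: palette_switch fW xC yC.
  have <- : nth (false, false) [seq uv_state (o e) e K | K <- k4_parts] i
    = uv_state (o e) e (k4_part i) by rewrite (nth_map [::]).
  by apply: nth_deal; [exact: uv_state_count | rewrite size_map].
(* For an edge at an apex, the other end is the only corner in the class, and the apex switch was
   fitted to it. *)
by rewrite mem_cat => /orP[|]; [|rewrite mem_cat => /orP[]];
  case/allpairsP=> -[e d] [_ _ [-> -> ->]] /=; rewrite /in_apex /=;
  case: (corners d) => -[y1 y2] y3 /=;
  case: (in_piece _ y1); case: (in_piece _ y2); case: (in_piece _ y3) => // _ _;
  rewrite addbAC addbb.
Qed.

Lemma coloring_balanced : balanced_coloring (G1 o s) 85 coloring.
Proof.
split=> [|i]; first exact: card_coloring.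
have -> : [set x | i \in coloring x] = [set x | color_class i x].
  by apply/setP => x; rewrite !inE.
exact: color_class_balanced.
Qed.

End Coloring.

Local Open Scope ring_scope.

Theorem theorem3 (o : k4e -> bool) (s : k4e -> tri -> bool * bool * bool)
    (hs : admissible_signs o s) :
  is_chi_fb (G1 o s) (2 + 2 / 85) /\ 2 + 2 / 85 = 172 / 85 :> rat.
Proof.
have rE : 2 + 2 / 85 = 172 / 85 :> rat by apply/eqP; vm_compute.
split; last exact: rE.
rewrite rE; split.
  by exists 172, 85, (coloring o); split; [|exact: coloring_balanced|].
move=> p q c q_gt0 cb; have le_pq := balanced_coloring_bound hs cb.
have q_pos : 0 < q%:R :> rat by rewrite ltr0n.
have pos85 : 0 < 85 :> rat by rewrite ltr0n.
rewrite (ler_pdivlMr _ _ q_pos) mulrAC (ler_pdivrMr _ _ pos85) -!natrM ler_nat.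
by rewrite [(p * 85)%N]mulnC.
Qed.
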